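(* Let $X$ be a compact metric space such that $\dim_B X$ exists, and let $(X,\mu,\mathcal F)$ and $(X,\mu',\mathcal F')$ be two box-counting spaces. Then $\mu\sim\mu'$, i.e. there exists $\zeta>0$ such that $\zeta^{-1}\mu(A)\le\mu'(A)\le\zeta\mu(A)$ for every Borel set $A\subset X$.
   Context: Let $(X,d_X)$ be a compact metric space; $B(x,r)$ denotes the (open) ball in $X$ with center $x$ and radius $r$. For $A\subset X$ and $\delta>0$, a family of balls of $X$ of radius $\delta$ is a $\delta$-ball-packing of $A$ if the balls are pairwise disjoint and their centers lie in $A$. $\mathcal N_\delta(A)$ is the maximal cardinality of a $\delta$-ball-packing of $A$. The box dimension is $\dim_B X=\lim_{\delta\to0}\frac{\log \mathcal N_\delta(X)}{-\log\delta}$, when this limit exists. Compact Vitalli-type covering: a sequence $\mathcal F=\{\mathcal F_k\}_{k\ge1}$ where each $\mathcal F_k$ is a covering of $X$ by subsets of $X$, such that (i) every element of $\mathcal F_k$ is compact; (ii) there is an integer $\lambda$ such that for all $k\ge1$ every point $x\in X$ is covered by at most $\lambda$ elements of $\mathcal F_k$; (iii) $\max\{\operatorname{diam}A: A\in\mathcal F_k\}\to0$ as $k\to\infty$. Box-counting space: suppose $\beta=\dim_B X$ exists, let $\mu$ be a finite Borel measure on $X$ and $\mathcal F$ a compact Vitalli-type covering of $X$. $(X,\mu,\mathcal F)$ is a box-counting space (and $\mu$ is an $\mathcal F$-box-counting measure) if there is a constant $M>0$ such that for every $R\in\bigcup_{k\ge1}\mathcal F_k$ there is $\delta_0(R)>0$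 with $$M^{-1}\mu(R)\le \mathcal N_\delta(R)\,\delta^{\beta}\le M\mu(R)\qquad\text{for all }0<\delta\le\delta_0(R).$$
   Formalization: Each covering F_k in a compact Vitalli-type covering is additionally required to be finite; with infinite F_k the claim fails, because the thresholds δ_0(R) depend on R and an atom of one measure can be missed by the other. *)

(* Defs.v *)
From HB Require Import structures.
From mathcomp Require Import all_boot all_order all_algebra.
From mathcomp Require Import all_classical all_reals all_analysis.
Import Order.TTheory GRing.Theory Num.Theory.
Import numFieldNormedType.Exports.

Set Implicit Arguments.
Unset Strict Implicit.
Unset Printing Implicit Defensive.

Local Open Scope classical_set_scope.
Local Open Scope ring_scope.

(* Metric spaces with a distinguished point: the library only puts a generated
   sigma-algebra on a pointed type. *)
#[short(type="pmetricType")]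
HB.structure Definition PointedMetric (R : numDomainType) :=
  {T of PseudoPointedMetric R T & Metric R T}.

Notation borel X := (g_sigma_algebraType (@open X)).

Section BoxCounting.
Context {R : realType} {X : pmetricType R}.

(* A packing is given by the set D of the centers of its balls: for delta > 0,
   pairwise disjoint balls of radius delta have pairwise distinct centers. *)
Definition ball_packing (delta : R) (A D : set X) : Prop :=
  D `<=` A /\ trivIset D (fun c => ball c delta).

(* When X is compact and delta > 0, the cardinalities of packings are bounded,
   hence this supremum is a maximum (and all packings are finite). *)
Definition packing_number (delta : R) (A : set X) : R :=
  sup [set n%:R | n in
        [set n : nat | exists2 D, ball_packing delta A D & (D #= `I_n)%card]].

End BoxCounting.

Section BoxDimension.
Context {R : realType}.

Definition box_ratio (X : pmetricType R) (delta : R) : R :=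
  ln (packing_number delta [set: X]) / - ln delta.

Definition has_box_dim (X : pmetricType R) : Prop :=
  cvg (box_ratio X @ 0^'+).

Definition box_dim (X : pmetricType R) : R :=
  lim (box_ratio X @ 0^'+).

End BoxDimension.

Section BoxCountingSpace.
Context {R : realType} {X : pmetricType R}.

Definition diam (A : set X) : R :=
  sup [set mdist p.1 p.2 | p in A `*` A].

(* Coverings are indexed by k >= 1; the value F 0 is irrelevant. Each covering
   is finite, so that the supremum of the diameters is a maximum. Without
   finiteness, pointwise thresholds delta0 in box_counting_space would no
   longer determine the measure up to equivalence. *)
Record compact_vitali_covering (F : nat -> set (set X)) : Prop := {
  cvc_cover : forall k, (1 <= k)%N -> \bigcup_(A in F k) A = setT ;
  cvc_finite : forall k, (1 <= k)%N -> finite_set (F k) ;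
  cvc_compact : forall k A, (1 <= k)%N -> F k A -> compact A ;
  cvc_overlap : exists lambda : nat, forall k x, (1 <= k)%N ->
    ([set A | F k A /\ A x] #<= `I_lambda)%card ;
  cvc_diam : sup [set diam A | A in F k] @[k --> \oo] --> (0 : R)
}.

Definition box_counting_space (mu : {finite_measure set (borel X) -> \bar R})
    (F : nat -> set (set X)) : Prop :=
  compact_vitali_covering F /\
  exists2 M : R, 0 < M &
    forall A, (\bigcup_(k in [set k | (1 <= k)%N]) F k) A ->
    exists2 delta0 : R, 0 < delta0 &
      forall delta : R, 0 < delta <= delta0 ->
        (M^-1%:E * mu A <= (packing_number delta A * delta `^ box_dim X)%:E)%E /\
        ((packing_number delta A * delta `^ box_dim X)%:E <= M%:E * mu A)%E.

Definition measure_equivalent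
    (mu nu : {finite_measure set (borel X) -> \bar R}) : Prop :=
  exists2 zeta : R, 0 < zeta &
    forall A : set (borel X), measurable A ->
      (zeta^-1%:E * mu A <= nu A)%E /\ (nu A <= zeta%:E * mu A)%E.

End BoxCountingSpace.

(* Main.v *)
(* Let K be closed and U an open neighbourhood of K. Cover K by the members A' of
   a fine covering from F' that meet K, and compare the sum of their packing
   numbers at a small scale delta with the packing number of their union: choosing
   a random subfamily of the A' and keeping the centers with no other chosen
   member nearby loses at most a factor 2 ^ lambda', since by compactness small
   balls meet at most lambda' of the A'. The union is covered by the members A of
   a fine covering from F contained in U, packing numbers are subadditive, and the
   measures of the A sum up to at most lambda mu(U). Hence mu'(K) <= c mu(U), and
   regularity extends mu' <= c mu to all Borel sets. *)
Require Import Defs.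
From mathcomp Require Import all_boot all_order all_algebra.
From mathcomp Require Import all_classical all_reals all_analysis.
From mathcomp Require Import finmap measurable_realfun.
Import Order.TTheory GRing.Theory Num.Theory.
Import numFieldNormedType.Exports.

Set Implicit Arguments.
Unset Strict Implicit.
Unset Printing Implicit Defensive.

Local Open Scope classical_set_scope.
Local Open Scope ring_scope.

(** * Counting the index sets that isolate an element *)

(** Adding [i] to a subset of the complement of [J] is injective and yields a set meeting [J] in [i]
    alone; the complement of [J] has 2 ^ (#|I| - #|J|) subsets. *)
Lemma isolating_subsets_card (I : finType) (J : {set I}) (i : I) :
  i \in J ->
  (2 ^ #|I| <= 2 ^ #|J| * #|[set S : {set I} | J :&: S == [set i]%SET]%SET|)%N.
Proof.
move=> iJ; rewrite -(cardsC J) expnD leq_pmul2l ?expn_gt0//.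
rewrite -card_powerset.
have inj : {in powerset (~: J) &, injective (fun S => i |: S)%SET}.
  move=> S1 S2; rewrite !inE => s1 s2 /setP e; apply/setP => x.
  have := e x; rewrite !inE; case: (x =P i) => [->|//] _.
  have nS (S : {set I}) : S \subset (~: J)%SET -> i \in S = false.
    by move=> sS; apply/negP => /(fintype.subsetP sS); rewrite !inE iJ.
  by rewrite !nS.
rewrite -(card_in_imset inj); apply/subset_leq_card/fintype.subsetP.
move=> _ /imsetP[S + ->]; rewrite !inE => /fintype.subsetP sS.
apply/eqP/setP => x; rewrite !inE; case: (x =P i) => [->|_]; first by rewrite iJ.
by apply/negP => /andP[xJ /sS]; rewrite !inE xJ.
Qed.

(* Average over all sets S of indices: an element v of index i is isolated by
   S, i.e. no other index near v lies in S, for a proportion 2 ^- L of the S. *)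
Lemma sum_size_le_isolated (T : eqType) (I : finType) (D : I -> seq T)
    (near : T -> {set I}) (L n : nat) :
  (forall i v, v \in D i -> i \in near v) ->
  (forall v, #|near v| <= L)%N ->
  (forall S : {set I},
    \sum_i count (fun v => near v :&: S == [set i]%SET) (D i) <= n)%N ->
  (\sum_i size (D i) <= 2 ^ L * n)%N.
Proof.
move=> Dnear nearL isol; rewrite -(@leq_pmul2l (2 ^ #|I|)) ?expn_gt0//.
rewrite mulnCA.
have -> : (2 ^ #|I| * n = \sum_(S : {set I}) n)%N.
  by rewrite sum_nat_const -cardsT -card_powerset powersetT cardsT.
apply: (@leq_trans (2 ^ L * \sum_(S : {set I})
    \sum_i count (fun v => near v :&: S == [set i]%SET) (D i))%N); last first.
  by rewrite leq_mul2l leq_sum ?orbT.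
(* After the exchange of sums the claim is checked for each [v] of [D i] separately: [v] is counted
   once for every [S] that isolates it. *)
rewrite exchange_big big_distrr big_distrr /=; apply: leq_sum => i _.
under [X in (_ <= _ * X)%N]eq_bigr do rewrite -sum1_count big_mkcond /=.
rewrite exchange_big -sum1_size !big_distrr /= [leqLHS]big_seq [leqRHS]big_seq.
apply: leq_sum => v /Dnear /isolating_subsets_card; rewrite muln1.
rewrite -big_mkcond sum1dep_card => /leq_trans; apply.
by rewrite leq_mul2r leq_exp2l// nearL orbT.
Qed.

(** * Packing numbers: attainment, subadditivity and near-additivity *)

Section Packings.
Context {R : realType} {X : pmetricType R}.
Hypothesis Xcompact : compact [set: X].
Implicit Types (A : set X) (delta : R) (s : seq X).

(** Finitely many balls of radius [delta] cover the space. Two centers of a packing cannot share one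
    of these balls, since the center of that ball would lie in both of their own balls. *)
Lemma packing_bounded delta : 0 < delta -> exists m : nat,
  forall s, uniq s -> ball_packing delta [set: X] [set` s] -> (size s <= m)%N.
Proof.
move=> delta0; move: Xcompact; rewrite compact_cover.
move=> /(_ X setT (fun x => (ball x delta)°)) [||E _ cE].
- by move=> x _; exact: open_interior.
- by move=> x _; exists x => //; exact: nbhsx_ballx.
have {}cE x : {y | y \in E & ball x delta y}.
  apply: cid2; have [y yE /interior_subset xy] := cE x Logic.I.
  by exists y => //; exact: ball_sym.
exists #|` E|; move=> s us [_ tr].
pose f x := s2val (cE x).
rewrite -(size_map f) uniq_leq_size//.
  rewrite map_inj_in_uniq// => x y xs ys fxy; apply: tr => //.
  exists (f x); split; first exact: (s2valP' (cE x)).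
  by rewrite fxy; exact: (s2valP' (cE y)).
by move=> _ /mapP[x _ ->]; exact: (s2valP (cE x)).
Qed.

Lemma ball_packing_sub delta A B D :
  A `<=` B -> ball_packing delta A D -> ball_packing delta B D.
Proof. by move=> AB [DA tD]; split => // x /DA /AB. Qed.

Lemma packing_seqP delta A (n : nat) :
  (exists2 D, ball_packing delta A D & (D #= `I_n)%card) <->
  (exists s, [/\ uniq s, ball_packing delta A [set` s] & size s = n]).
Proof.
split=> [[D pD Dn]|[s [us ps sn]]].
- have fD : finite_set D by exists n.
  exists (fset_set D); split; first exact: fset_uniq.
    by rewrite fset_setK.
  exact: card_fset_set.
- exists [set` s] => //.
  have -> : [set` s] = [set` [fset x in s]%fset].
    by apply/seteqP; split => x /=; rewrite inE.
  by apply/card_eq_fsetP; rewrite card_fseq undup_id.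
Qed.

(** By compactness the real supremum ranges over boundedly many integers, so it is attained. Later
    arguments use packing numbers only through these two properties. *)
Lemma packing_number_max delta A : 0 < delta ->
  (forall s, uniq s -> ball_packing delta A [set` s] ->
    (size s)%:R <= packing_number delta A) /\
  (exists s, [/\ uniq s, ball_packing delta A [set` s] &
    packing_number delta A = (size s)%:R]).
Proof.
move=> delta0; have [m mP] := packing_bounded delta0.
pose P n := exists s, [/\ uniq s, ball_packing delta A [set` s] & size s = n].
have Pm n : `[< P n >] -> (n <= m)%N.
  move=> /asboolP[s [us ps <-]]; apply: mP => //.
  exact: ball_packing_sub ps.
have P0 : exists n, `[< P n >].
  by exists 0%N; apply/asboolP; exists [::]; split => //; split => // x.
have [n /asboolP[s [us ps sn]] nmax] := ex_maxnP P0 Pm.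
have ubP : ubound [set (k%:R : R) | k in
    [set k | exists2 D, ball_packing delta A D & (D #= `I_k)%card]] n%:R.
  move=> _ [k /packing_seqP Pk <-]; rewrite ler_nat; apply: nmax.
  exact/asboolP.
have inP s' : uniq s' -> ball_packing delta A [set` s'] ->
    (size s')%:R <= packing_number delta A.
  move=> us' ps'; apply: ub_le_sup; first by exists n%:R.
  by exists (size s') => //; apply/packing_seqP; exists s'.
split=> //; exists s; split=> //; apply/le_anti; rewrite inP// andbT sn.
apply: ge_sup => //; exists n%:R; exists n => //.
by apply/packing_seqP; exists s.
Qed.

(** The centers of an optimal packing of [A] that lie in [B i] form a packing of [B i], and every
    center is counted at least once. *)
Lemma packing_number_bigcup_le (I : finType) (B : I -> set X) delta A :
  0 < delta -> A `<=` \bigcup_i B i ->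
  packing_number delta A <= \sum_i packing_number delta (B i).
Proof.
move=> d0 AB; have [_ [s [us [sA ts] ->]]] := packing_number_max A d0.
apply: (@le_trans _ _ (\sum_i count (fun x => x \in B i) s)%N%:R).
  rewrite ler_nat -sum1_size.
  under [leqRHS]eq_bigr do rewrite -sum1_count big_mkcond.
  rewrite exchange_big /= [leqLHS]big_seq [leqRHS]big_seq.
  apply: leq_sum => x /sA /AB[i _ Bix].
  by rewrite (bigD1 i)//= mem_set.
rewrite natr_sum; apply: ler_sum => i _.
have [+ _] := packing_number_max (B i) d0; rewrite -size_filter; apply.
  exact: filter_uniq.
split=> [x /=|x y /=]; rewrite mem_filter => /andP[xB xs]; first exact/set_mem.
by rewrite mem_filter => /andP[_ ys]; exact: ts.
Qed.

(** Balls of optimal packings [D i] for different [i] may meet. For each index set [S], the centers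
    isolated by [S] form a packing of the union; averaging over [S] costs the factor [2 ^+ L]. *)
Lemma sum_packing_number_le (I : finType) (A : I -> set X) delta r (L : nat) :
  0 < delta -> delta + delta <= r ->
  (forall x, #|[set i | `[< A i `&` ball x r !=set0 >]]%SET| <= L)%N ->
  \sum_i packing_number delta (A i) <=
    2 ^+ L * packing_number delta (\bigcup_i A i).
Proof.
move=> d0 dr ovl.
have /choice[D DP] i := (packing_number_max (A i) d0).2.
have [sle [s0 [us0 ps0 e0]]] := packing_number_max (\bigcup_i A i) d0.
rewrite e0 (eq_bigr (fun i => (size (D i))%:R)); last first.
  by move=> i _; have [] := DP i.
rewrite -natr_sum -natrX -natrM ler_nat.
pose near x := [set i | `[< A i `&` ball x r !=set0 >]]%SET.
(* Centers of meeting balls are less than [delta + delta <= r] apart. *)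
have nearE i x y : y \in D i -> ball x delta `&` ball y delta !=set0 ->
    i \in near x.
  move=> yDi [z [xz yz]]; rewrite inE; apply/asboolP; exists y; split.
    by have [_ [+ _] _] := DP i; apply.
  by apply: (le_ball dr); apply: ball_triangle xz _; exact: ball_sym.
have inear i x : x \in D i -> i \in near x.
  by move=> xD; apply: nearE xD _; exists x; split; exact: ballxx.
apply: (@sum_size_le_isolated _ _ D near) => //= S.
pose E i := [seq v <- D i | near v :&: S == [set i]%SET].
under eq_bigr do rewrite -size_filter -/(E _).
(* If the two balls meet, then [j] is near [x] and belongs to [S]; as [x] is isolated with index
   [i], this forces [j = i]. *)
have sep i j x y : x \in E i -> y \in E j ->
    ball x delta `&` ball y delta !=set0 -> i = j.
  rewrite !mem_filter => /andP[/eqP Ex xD] /andP[/eqP Ey yD] xy.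
  have jS : j \in S by have := set11 j; rewrite -Ey inE => /andP[].
  by apply/esym/set1P; rewrite -Ex finset.inE jS (nearE _ _ _ yD xy).
pose s := [seq x | i <- enum I, x <- E i].
have ss : size s = (\sum_i size (E i))%N.
  by rewrite /s size_allpairs_dep sumnE big_map big_enum.
have sP x : x \in s -> exists i, x \in E i.
  by move=> /allpairsPdep[i [y [_ yE ->]]]; exists i.
rewrite -ss -(ler_nat R) -e0; apply: sle.
  apply: allpairs_uniq_dep; first exact: enum_uniq.
    by move=> i _; rewrite filter_uniq//; have [] := DP i.
  move=> _ _ /allpairsPdep[i [x [_ xE ->]]] /allpairsPdep[j [y [_ yE ->]]] /= xy.
  rewrite -xy in yE *; congr existT; apply: sep xE yE _.
  by exists x; split; exact: ballxx.
split=> [x /sP[i]|x y /sP[i xE] /sP[j yE] xy].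
  rewrite mem_filter => /andP[_ xD]; exists i => //.
  by have [_ [+ _] _] := DP i; apply.
have ij := sep _ _ _ _ xE yE xy; rewrite -ij in yE.
have [_ [_ +] _] := DP i; apply => //=.
  by move: xE; rewrite mem_filter => /andP[].
by move: yE; rewrite mem_filter => /andP[].
Qed.

End Packings.

(** * Uniform radii and diameters in compact metric spaces *)

Section CompactMetric.
Context {R : realType} {X : pmetricType R}.
Implicit Types (A K U : set X) (r : R).

(** If the ball of radius [e] at [x] lies in [U], radius [e / 2] serves all centers within [e / 2]
    of [x]; compactness makes the radius uniform. *)
Lemma compact_ball_sub_open K U : compact K -> open U -> K `<=` U ->
  \forall r \near 0^'+, forall x, K x -> ball x r `<=` U.
Proof.
move=> /compact_near_coveringP cK oU KU.
apply: (cK _ _ (fun r x => ball x r `<=` U)) => x Kx.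
have [e /= e0 eU] : nbhs_ball x U.
  by rewrite nbhs_ballE; exact: (open_nbhs_nbhs (conj oU (KU _ Kx))).
near=> x' r => /= y ry; apply: eU; rewrite [e]splitr.
have : ball x (e / 2) x'.
  by near: x'; apply: nbhsx_ballx; rewrite divr_gt0.
move/ball_triangle; apply; apply: le_ball ry.
by near: r; apply: nbhs_right_le; rewrite divr_gt0.
Unshelve. all: by end_near. Qed.

(** A small enough ball at [x] misses the finitely many closed sets that do not contain [x], so
    balls near [x] meet only members through [x]; compactness makes the radius uniform. *)
Lemma overlap_ball_near (I : finType) (A : I -> set X) (L : nat) :
  compact [set: X] -> (forall i, closed (A i)) ->
  (forall x, #|[set i | `[< A i x >]]%SET| <= L)%N ->
  \forall r \near 0^'+,
    forall x, (#|[set i | `[< A i `&` ball x r !=set0 >]]%SET| <= L)%N.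
Proof.
move=> /compact_near_coveringP cX cA ovl.
suff : \forall r \near (0 : R)^'+, forall x, [set: X] x ->
    (#|[set i | `[< A i `&` ball x r !=set0 >]]%SET| <= L)%N.
  by apply: filterS => r rP x; exact: rP.
apply: (cX _ _ (fun r x =>
  (#|[set i | `[< A i `&` ball x r !=set0 >]]%SET| <= L)%N)) => x _.
have [e /= e0 eA] : nbhs_ball x [set y | forall i, ~ A i x -> ~ A i y].
  rewrite nbhs_ballE; apply: filter_forall => i.
  have [Aix|nAix] := pselect (A i x); first by apply: nearW => y nAix; case: nAix.
  have : nbhs x (~` A i) by apply: open_nbhs_nbhs; split => //; exact: closed_openC.
  by apply: filterS => y nAiy _.
near=> x' r => /=; apply: leq_trans (ovl x); apply/subset_leq_card/fintype.subsetP.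
move=> i; rewrite !finset.inE => /asboolP[y [Aiy ry]]; apply/asboolP.
apply: contrapT => nAix; suff /eA/(_ i nAix) : ball x e y by [].
rewrite [e]splitr.
have : ball x (e / 2) x'.
  by near: x'; apply: nbhsx_ballx; rewrite divr_gt0.
move/ball_triangle; apply; apply: le_ball ry.
by near: r; apply: nbhs_right_le; rewrite divr_gt0.
Unshelve. all: by end_near. Qed.

Lemma compact_mdist_bounded : compact [set: X] ->
  exists b : R, forall x y : X, mdist x y <= b.
Proof.
move=> /compact_near_coveringP cX.
have [M [_ MP]] : \forall M \near +oo, forall x, [set: X] x ->
    mdist (point : X) x <= M.
  apply: (cX _ _ (fun M x => mdist (point : X) x <= M)) => x _.
  near=> x' M => /=; apply: le_trans (metric_triangle point x x') _.
  apply: (@le_trans _ _ (mdist (point : X) x + 1)).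
    rewrite lerD2l; have : ball x 1 x' by near: x'; exact: nbhsx_ballx.
    by rewrite ballEmdist => /ltW.
  by near: M; apply: nbhs_pinfty_ge; rewrite num_real.
have {}MP x : mdist (point : X) x <= M + 1 by apply: MP => //; rewrite ltrDl.
exists ((M + 1) + (M + 1)) => x y; apply: le_trans (metric_triangle x point y) _.
by rewrite lerD// metric_sym.
Unshelve. all: by end_near. Qed.

Lemma mdist_le_diam A x y : compact [set: X] -> A x -> A y ->
  mdist x y <= diam A.
Proof.
move=> /compact_mdist_bounded[b bP] Ax Ay; apply: ub_le_sup.
  by exists b => _ [[u v] _ <-]; exact: bP.
by exists (x, y).
Qed.

Lemma diam_bounded : compact [set: X] -> exists b : R, forall A, diam A <= b.
Proof.
move=> /compact_mdist_bounded[b bP]; exists b => A; rewrite /diam.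
(* The supremum of the empty set is 0, which is the distance of a point to itself and so at most
   [b]. *)
have [->|A0] := eqVneq [set mdist p.1 p.2 | p in A `*` A] set0.
  by rewrite sup0 -(mdistxx (point : X)).
by apply: ge_sup; [exact/set0P|move=> _ [[u v] _ <-]; exact: bP].
Qed.

(** Diameters are uniformly bounded, so the suprema that tend to 0 really dominate the diameter of
    each member. *)
Lemma cvc_small_mesh (F : nat -> set (set X)) r :
  compact [set: X] -> compact_vitali_covering F -> 0 < r ->
  exists2 k, (1 <= k)%N &
    forall A, F k A -> forall x y, A x -> A y -> mdist x y < r.
Proof.
move=> cX vF r0; have /cvgrPdist_lt/(_ r r0)[N _ NP] := cvc_diam vF.
exists N.+1 => // A FA x y Ax Ay.
apply: le_lt_trans (mdist_le_diam cX Ax Ay) _.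
have := NP N.+1 (leqnSn N); rewrite /= sub0r normrN; apply: le_lt_trans.
apply: le_trans (ler_norm _); apply: ub_le_sup; last by exists A.
have [b bP] := diam_bounded cX.
by exists b => _ [B _ <-]; exact: bP.
Qed.

End CompactMetric.

(** * Measures of finite families, by integrating sums of indicators *)

Section OverlapMeasure.
Context d (T : measurableType d) (R : realType) (mu : {measure set T -> \bar R}).
Local Open Scope ereal_scope.

(** The sum of the indicators of the [A i] is at most [L] on [U]. *)
Lemma sum_measure_overlap_le (I : finType) (A : I -> set T) (U : set T)
    (L : nat) :
  (forall i, measurable (A i)) -> measurable U -> (forall i, A i `<=` U) ->
  (forall x, #|[set i | `[< A i x >]]%SET| <= L)%N ->
  \sum_i mu (A i) <= L%:R%:E * mu U.
Proof.
move=> mA mU AU ovl.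
have -> : \sum_i mu (A i) = \sum_i \int[mu]_(x in U) (\1_(A i) x)%:E.
  by apply: eq_bigr => i _; rewrite integral_indic// setIidl.
rewrite -ge0_integral_sum//; last first.
  by move=> i; exact/measurable_EFinP/measurable_indic.
rewrite -integral_cst//; apply: ge0_le_integral => //.
- by move=> x _; apply: sume_ge0 => i _; rewrite lee_fin.
- by apply: emeasurable_sum => i; exact/measurable_EFinP/measurable_indic.
- move=> x _; rewrite sumEFin lee_fin /=.
  apply: (@le_trans _ _ (#|[set i | `[< A i x >]]%SET|%:R)); last by rewrite ler_nat.
  rewrite -sum1dep_card natr_sum [leRHS]big_mkcond; apply: ler_sum => i _.
  by rewrite indicE -[x \in A i]/`[< A i x >]; case: ifP.
Qed.

(** The sum of the indicators of the [A i] is at least 1 on [B]. *)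
Lemma measure_bigcup_fin_le (I : finType) (A : I -> set T) (B : set T) :
  (forall i, measurable (A i)) -> measurable B -> B `<=` \bigcup_i A i ->
  mu B <= \sum_i mu (A i).
Proof.
move=> mA mB BA; rewrite -[leLHS]mul1e -integral_cst//.
apply: (@le_trans _ _ (\int[mu]_(x in B) \sum_i (\1_(A i) x)%:E)).
  apply: ge0_le_integral => //.
    by apply: emeasurable_sum => i; exact/measurable_EFinP/measurable_indic.
  move=> x /BA[i _ Aix]; rewrite sumEFin lee_fin (bigD1 i)//= indicE mem_set//.
  by rewrite lerDl sumr_ge0.
rewrite ge0_integral_sum//; last first.
  by move=> i; exact/measurable_EFinP/measurable_indic.
by apply: lee_sum => i _; rewrite integral_indic//; exact: measureIl.
Qed.

End OverlapMeasure.

(** * Regularity of finite Borel measures on a metric space *)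

Section Regularity.
Context {R : realType} {X : pmetricType R}.
Variable mu : {finite_measure set (borel X) -> \bar R}.

Lemma borel_open (U : set X) : open U -> measurable (U : set (borel X)).
Proof. by move=> oU; exact: sub_sigma_algebra. Qed.

Lemma borel_closed (C : set X) : closed C -> measurable (C : set (borel X)).
Proof.
move=> cC; rewrite -[C]setCK; apply: measurableC.
by apply: borel_open; exact: closed_openC.
Qed.

(** Continuity from above of a finite measure: if every [D n] had measure at least [e], so would the
    intersection. *)
Lemma nonincreasing_measure_lt (D : nat -> set (borel X)) (e : R) :
  (forall n, measurable (D n)) ->
  (forall m n, (m <= n)%N -> D n `<=` D m) -> (mu (\bigcap_n D n) < e%:E)%E ->
  exists n, (mu (D n) < e%:E)%E.
Proof.
move=> mD nD.
rewrite ltNge => /negP eD; apply: contrapT => /forallNP De; apply: eD.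
apply: (@cvge_ge nat \oo _ R (mu \o D) _ e%:E); last first.
  apply: nonincreasing_cvg_mu => //.
  - by rewrite -ge0_fin_numE// fin_num_measure.
  - exact: bigcapT_measurable.
  - by move=> m n mn; apply/subsetPset; exact: nD.
by apply: nearW => n; rewrite leNgt; apply/negP/De.
Qed.

(* The sets A with this property form a sigma-algebra; it contains the open sets
   because they are F_sigma. *)
Lemma borel_regular (A : set (borel X)) : measurable A ->
  forall e : R, 0 < e -> exists C U : set X, [/\ closed C, open U,
    C `<=` A, A `<=` U & (mu (U `\` C) < e%:E)%E].
Proof.
pose good : set (set (borel X)) := [set A | forall e : R, 0 < e ->
  exists C U : set X, [/\ closed C, open U,
    C `<=` A, A `<=` U & (mu (U `\` C) < e%:E)%E]].
rewrite -/(good A); move: A; apply: smallest_sub; last first.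
  move=> U oU e e0; pose r (n : nat) : R := n.+1%:R^-1.
  have r0 n : 0 < r n by rewrite invr_gt0.
  (* The points at distance at least [r n] from the complement of [U]; these closed sets increase to
     [U]. *)
  pose C n : set X := ~` (\bigcup_(y in ~` U) (ball y (r n))°).
  have CU n : C n `<=` U.
    move=> x Cx; apply: contrapT => nUx; apply: Cx; exists x => //.
    exact: nbhsx_ballx.
  have cC n : closed (C n).
    by apply: open_closedC; apply: bigcup_open => y _; exact: open_interior.
  have [n Cn] : exists n, (mu (U `\` C n) < e%:E)%E.
    apply: nonincreasing_measure_lt.
    - by move=> n; apply: measurableD; [exact: borel_open|exact: borel_closed].
    - move=> m n mn; apply: setDS.
      apply: subsetC => x [y Uy xy]; exists y => //.
      apply: interiorS xy; apply: le_ball.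
      by rewrite lef_pV2 ?posrE// ler_nat ltnS.
    - rewrite (_ : \bigcap_n _ = set0) ?measure0 ?lte_fin//.
      rewrite -subset0 => x Dx; have [Ux _] := Dx 0%N Logic.I.
      have [d /= d0 dU] : nbhs_ball x U.
        by rewrite nbhs_ballE; exact: open_nbhs_nbhs.
      have [n nd] : exists n, r n < d.
        by have [n _ /(_ n (leqnn n))] := near_infty_natSinv_lt (PosNum d0); exists n.
      have [_ /contrapT[y Uy /interior_subset yx]] := Dx n Logic.I.
      by apply/Uy/dU/(le_ball (ltW nd))/ball_sym.
  by exists (C n), U; split; [exact: cC| |exact: CU| |].
split.
- move=> e e0; exists set0, set0; split => //; first exact: closed0.
    exact: open0.
  by rewrite set0D measure0 lte_fin.
- move=> A gA e e0; have [C [U [cC oU CA AU mUC]]] := gA e e0.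
  exists (~` U), (~` C); split.
  + exact: open_closedC.
  + exact: closed_openC.
  + by rewrite setTD; exact: subsetC.
  + by rewrite setTD; exact: subsetC.
  + by rewrite setDE setCK setIC -setDE.
- move=> A gA e e0.
  (* These errors sum up to [e / 2], leaving room for a strict inequality. *)
  pose e' n := e / 2 / (2 ^ n.+1)%:R.
  have e'0 n : 0 < e' n by rewrite !divr_gt0.
  have /choice[C /choice[U CUP]] n := gA n (e' n) (e'0 n).
  pose V : set X := \bigcup_n U n.
  (* The union of all [C k] need not be closed; finite unions are, and [V] minus them decreases to a
     set covered by the [U k] minus [C k]. *)
  pose D n : set X := \bigcup_(k < n) C k.
  have oV : open V by apply: bigcup_open => n _; have [] := CUP n.
  have cD n : closed (D n).
    by apply: closed_bigcup => // k _; have [] := CUP k.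
  have [n Dn] : exists n, (mu (V `\` D n) < e%:E)%E.
    apply: nonincreasing_measure_lt.
    - by move=> n; apply: measurableD; [exact: borel_open|exact: borel_closed].
    - move=> m n mn; apply: setDS.
      by move=> x [k /= km Ckx]; exists k => //=; exact: leq_trans mn.
    - have mUC n : measurable (U n `\` C n : set (borel X)).
        have [cC oU _ _ _] := CUP n.
        by apply: measurableD; [exact: borel_open|exact: borel_closed].
      apply: (@le_lt_trans _ _ (\sum_(n <oo) mu (U n `\` C n))%E).
        apply: measure_sigma_subadditive => //.
          apply: bigcapT_measurable => n.
          by apply: measurableD; [exact: borel_open|exact: borel_closed].
        move=> x Dx; have [[n _ Unx] _] := Dx 0%N Logic.I.
        exists n => //; split => // Cnx.
        by have [_] := Dx n.+1 Logic.I; apply; exists n => /=.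
      apply: (@le_lt_trans _ _ (e / 2)%:E); last first.
        by rewrite lte_fin ltr_pdivrMr// ltr_pMr// ltr1n.
      apply: le_trans (epsilon_trick0 xpredT _); last by rewrite divr_ge0// ltW.
      by apply: lee_nneseries => // n _; apply/ltW; have [] := CUP n.
  exists (D n), V; split => //.
    move=> x [k _ Ckx]; exists k => //.
    by have [_ _ CA _ _] := CUP k; exact: CA.
  move=> x [k _ Akx]; exists k => //.
  by have [_ _ _ AU _] := CUP k; exact: AU.
Qed.

End Regularity.

(** * Comparison of two box-counting measures *)

(** Transfers the overlap bound of a covering to its members viewed as a finite index type, as the
    counting lemmas require. *)
Lemma card_fset_set_overlap (T : choiceType) (G : set (set T)) (x : T)
    (L : nat) : finite_set G -> ([set A | G A /\ A x] #<= `I_L)%card ->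
  (#|[set i : fset_set G | `[< fsval i x >]]%SET| <= L)%N.
Proof.
move=> fG GL; set J := finset _; pose E := [fset fsval i | i in J]%fset.
have EJ : #|` E| = #|J|.
  by rewrite card_imfset /= -?cardE//; exact: val_inj.
have EI : ([set` E] #= `I_#|J|)%card by apply/card_eq_fsetP.
rewrite -card_le_II -(card_le_eql EI); apply: card_le_trans GL.
apply: subset_card_le => A /= /imfsetP[i /=]; rewrite finset.inE => /asboolP ix ->.
by split=> //; have := fsvalP i; rewrite in_fset_set// => /set_mem.
Qed.

Section Comparison.
Context {R : realType} {X : pmetricType R}.
Hypothesis Xcompact : compact [set: X].

(** Finitely many member-dependent thresholds leave a common range of scales. *)
Lemma near_threshold (I : finType) (P : I -> R -> Prop) :
  (forall i, exists2 d0 : R, 0 < d0 & forall d, 0 < d <= d0 -> P i d) ->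
  \forall d \near 0^'+, forall i, P i d.
Proof.
move=> IP; apply: filter_forall => i; have [d0 d00 d0P] := IP i.
near=> d; apply: d0P; apply/andP; split; near: d.
  exact: nbhs_right_gt.
exact: nbhs_right_le.
Unshelve. all: by end_near. Qed.

Lemma closed_le_open (mu mu' : {finite_measure set (borel X) -> \bar R})
    (F F' : nat -> set (set X)) :
  box_counting_space mu F -> box_counting_space mu' F' ->
  exists2 c : R, 0 < c & forall K U : set X, closed K -> open U ->
    K `<=` U -> (mu' K <= c%:E * mu U)%E.
Proof.
move=> [vF [M M0 HM]] [vF' [M' M'0 HM']].
have [L0 ovl0] := cvc_overlap vF; have [L' ovl'] := cvc_overlap vF'.
(* The successor makes [L], and with it the constant below, positive. *)
pose L := L0.+1.
(* [M'] and [M] convert measures to packing numbers and back, [2 ^+ L'] pays for the thinning of the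
   members from [F'], and [L] for the overlap of those from [F]. *)
exists (M' * 2 ^+ L' * (M * L%:R)); first by rewrite !mulr_gt0 ?exprn_gt0.
move=> K U cK oU KU.
have /(compact_ball_sub_open) /(_ oU KU) : compact K.
  exact: subclosed_compact Xcompact _.
move=> /(filterI (nbhs_right_gt 0))/filter_ex[r [/= r0 rU]].
have r20 : 0 < r / 2 by rewrite divr_gt0.
have [k k1 kF] := cvc_small_mesh Xcompact vF r20.
have [k' k'1 k'F] := cvc_small_mesh Xcompact vF' r20.
pose G := F k `&` [set A | A `<=` U].
pose G' := F' k' `&` [set A | A `&` K !=set0].
have fG : finite_set G by apply: finite_setIl; exact: cvc_finite.
have fG' : finite_set G' by apply: finite_setIl; exact: cvc_finite.
have GP (i : fset_set G) : G (fsval i).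
  by have := fsvalP i; rewrite in_fset_set// => /set_mem.
have G'P (i : fset_set G') : G' (fsval i).
  by have := fsvalP i; rewrite in_fset_set// => /set_mem.
have inG A : G A -> exists i : fset_set G, fsval i = A.
  by move=> GA; have h : A \in fset_set G; [rewrite in_fset_set// mem_set|exists [` h]%fset].
have inG' A : G' A -> exists i : fset_set G', fsval i = A.
  by move=> GA; have h : A \in fset_set G'; [rewrite in_fset_set// mem_set|exists [` h]%fset].
have Gclosed (i : fset_set G) : closed (fsval i).
  apply: compact_closed; first exact: metric_hausdorff.
  by apply: cvc_compact vF _ _ k1 _; have [] := GP i.
have G'closed (i : fset_set G') : closed (fsval i).
  apply: compact_closed; first exact: metric_hausdorff.
  by apply: cvc_compact vF' _ _ k'1 _; have [] := G'P i.
have ovlG x : (#|[set i : fset_set G | `[< fsval i x >]]%SET| <= L)%N.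
  apply: card_fset_set_overlap => //.
  apply: (@card_le_trans _ _ _ [set A | F k A /\ A x]).
    by apply: subset_card_le => A [[]].
  by apply: card_le_trans (ovl0 _ x k1) _; rewrite card_le_II.
have ovlG' x : (#|[set i : fset_set G' | `[< fsval i x >]]%SET| <= L')%N.
  apply: card_fset_set_overlap => //.
  apply: card_le_trans (ovl' _ x k'1).
  by apply: subset_card_le => A [[]].
have KG' : K `<=` \bigcup_(i : fset_set G') fsval i.
  move=> x Kx; have : [set: X] x by [].
  rewrite -(cvc_cover vF' k'1) => -[A FA Ax].
  by have [|i iA] := inG' A; [split => //; exists x|exists i; rewrite ?iA].
have G'G : \bigcup_(i : fset_set G') fsval i `<=`
    \bigcup_(i : fset_set G) fsval i.
  move=> y [i _ iy]; have : [set: X] y by [].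
  rewrite -(cvc_cover vF k1) => -[A FA Ay].
  have [Fi [x [ix Kx]]] := G'P i.
  have [|j jA] := inG A; last by exists j; rewrite ?jA.
  (* [A] meets a member that meets [K], and both have mesh below [r / 2], so [A] stays within [r] of
     [K], hence in [U]. *)
  split=> // z Az; apply: (rU x Kx); rewrite ballEmdist /=.
  apply: le_lt_trans (metric_triangle x y z) _.
  by rewrite [ltRHS]splitr; apply: ltrD; [exact: (k'F _ Fi)|exact: (kF _ FA)].
have [r1 [/= r10 r1P]] :=
  filter_ex (filterI (nbhs_right_gt 0) (overlap_ball_near Xcompact G'closed ovlG')).
have muG := near_threshold (fun i : fset_set G =>
  HM (fsval i) (ex_intro2 _ _ k k1 (GP i).1)).
have mu'G' := near_threshold (fun i : fset_set G' =>
  HM' (fsval i) (ex_intro2 _ _ k' k'1 (G'P i).1)).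
have r120 : 0 < r1 / 2 by rewrite divr_gt0.
(* One scale [d] serves both families: it is below all their thresholds and at most [r1 / 2]. *)
have [d [/= [d0 dr1] [dG dG']]] := filter_ex (filterI
  (filterI (nbhs_right_gt 0) (nbhs_right_le r120)) (filterI muG mu'G')).
pose w := d `^ box_dim X.
have w0 : 0 <= w by exact: powR_ge0.
have dd : d + d <= r1 by rewrite [leRHS]splitr lerD.
have step1 : (mu' K <= (M' * (\sum_(i : fset_set G')
    packing_number d (fsval i) * w))%:E)%E.
  apply: (le_trans (measure_bigcup_fin_le mu' _ (borel_closed cK) KG')).
    by move=> i; exact: borel_closed.
  rewrite mulr_sumr -sumEFin; apply: lee_sum => i _.
  have [+ _] := dG' i; rewrite -/w.
  by rewrite lee_pdivrMl.
have step2 : ((\sum_(i : fset_set G) packing_number d (fsval i) * w)%:E <=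
    (M * L%:R)%:E * mu U)%E.
  apply: (@le_trans _ _ (\sum_(i : fset_set G) (M%:E * mu (fsval i)))%E).
    by rewrite -sumEFin; apply: lee_sum => i _; have [_] := dG i.
  rewrite -ge0_sume_distrr// EFinM -muleA lee_pmul2l//.
  apply: sum_measure_overlap_le => //.
  - by move=> i; exact: borel_closed.
  - exact: borel_open.
  - by move=> i; have [] := GP i.
apply: (le_trans step1); rewrite [in leRHS]EFinM -[leRHS]muleA.
apply: (@le_trans _ _ ((M' * 2 ^+ L')%:E *
  (\sum_(i : fset_set G) packing_number d (fsval i) * w)%:E)%E); last first.
  by rewrite lee_pmul2l// lte_fin mulr_gt0// exprn_gt0.
(* With [M'] and [w] cancelled, only packing numbers at the scale [d] remain to be compared. *)
rewrite -EFinM lee_fin -mulrA ler_pM2l// -!mulr_suml mulrA ler_wpM2r//.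
apply: le_trans (sum_packing_number_le Xcompact d0 dd r1P) _.
rewrite ler_pM2l ?exprn_gt0//.
exact: packing_number_bigcup_le.
Qed.

(** Inner regularity of [mu'] gives a closed [C] inside [A], outer regularity of [mu] an open [V]
    around [C]; then [mu' C] is at most [c] times [mu V], up to small errors on both sides. *)
Lemma box_counting_le (mu mu' : {finite_measure set (borel X) -> \bar R})
    (F F' : nat -> set (set X)) :
  box_counting_space mu F -> box_counting_space mu' F' ->
  exists2 c : R, 0 < c & forall A : set (borel X), measurable A ->
    (mu' A <= c%:E * mu A)%E.
Proof.
move=> muF mu'F'; have [c c0 cP] := closed_le_open muF mu'F'.
exists c => // A mA; apply/lee_addgt0Pr => e e0.
have e20 : 0 < e / 2 by rewrite divr_gt0.
have [C [U [cC oU CA AU mUC]]] := borel_regular mu' mA e20.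
(* The error for [mu] is multiplied by [c] later, hence the division. *)
have e2c0 : 0 < e / 2 / c by rewrite divr_gt0.
have [C' [V [cC' oV C'C CV mVC]]] := borel_regular mu (borel_closed cC) e2c0.
have mC := borel_closed cC.
have subdiff (nu : {finite_measure set (borel X) -> \bar R})
    (B D E : set (borel X)) (a : R) : measurable B -> measurable D ->
    measurable E -> B `<=` D -> D `\` B `<=` E -> (nu E < a%:E)%E ->
    (nu D <= nu B + a%:E)%E.
  move=> mB mD mE BD DBE Ea; rewrite -{1}(setDUK BD).
  apply: le_trans (measureU2 _ mB (measurableD mD mB)) _.
  rewrite leeD2l//; apply: le_trans (ltW Ea).
  by apply: le_measure DBE; apply: mem_set => //; exact: measurableD.
have A_C : (mu' A <= mu' C + (e / 2)%:E)%E.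
  apply: subdiff mC mA _ CA _ mUC.
    by apply: measurableD; [exact: borel_open|exact: borel_closed].
  exact: setSD.
have V_C : (mu V <= mu C + (e / 2 / c)%:E)%E.
  apply: subdiff mC (borel_open oV) _ CV _ mVC.
    by apply: measurableD; [exact: borel_open|exact: borel_closed].
  exact: setDS.
apply: (le_trans A_C); rewrite [in leRHS](splitr e) EFinD addeA leeD2r//.
apply: (le_trans (cP _ _ cC oV CV)).
apply: (@le_trans _ _ (c%:E * (mu A + (e / 2 / c)%:E))%E).
  rewrite lee_pmul2l//; apply: (le_trans V_C); rewrite leeD2r//.
  by apply: le_measure => //; exact: mem_set.
by rewrite ge0_muleDr ?lee_fin ?(ltW e2c0)// -EFinM mulrC divfK// gt_eqF.
Qed.

End Comparison.

Theorem theorem1p2 (R : realType) (X : pmetricType R)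
    (Xcompact : compact [set: X]) (Xdim : has_box_dim X)
    (mu mu' : {finite_measure set (borel X) -> \bar R})
    (F F' : nat -> set (set X))
    (muF : box_counting_space mu F) (mu'F' : box_counting_space mu' F') :
  measure_equivalent mu mu'.
Proof.
have [c c0 cP] := box_counting_le Xcompact muF mu'F'.
have [c' c'0 c'P] := box_counting_le Xcompact mu'F' muF.
(* The sum dominates the constants of both directions. *)
exists (c + c'); first exact: addr_gt0.
move=> A mA; split.
  rewrite lee_pdivrMl ?addr_gt0//; apply: le_trans (c'P A mA) _.
  by rewrite lee_wpmul2r// lee_fin lerDr ltW.
apply: le_trans (cP A mA) _.
by rewrite lee_wpmul2r// lee_fin lerDl ltW.
Qed.
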